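(* Let $\sigma\in S_n$. One has $$p_n(\mathrm{id},\sigma)=\frac{N_n(l(\sigma))}{n^n},$$ where $N_n(l)$ denotes the number of nondecreasing $l$-paths of length $n$ and $l(\sigma)$ is the $(n-1)$-vector associated with $\sigma$, both as defined in the context.
   Context: A permutation $\sigma\in S_n$ is viewed as a deck of cards numbered $1,\dots,n$ laid out in a row, where $\sigma_j$ is the number of the card in the $j$-th position from the left; thus $\sigma^{-1}_i$ is the position of the card numbered $i$. The card-cyclic to random insertion shuffle removes each of the $n$ cards exactly once and immediately reinserts it in a position chosen uniformly from the $n$ possible positions (independently of the other insertions); the removals and reinsertions are performed one card at a time in the original left-to-right order of the cards. Starting from the identity $\mathrm{id}$ (cards in increasing order from left to right), the cards are thus removed and reinserted in the order $1,2,\dots,n$, and after card $j$ is reinserted in ''position $k$'' it is the $k$-th card from the left. $p_n(\mathrm{id},\sigma)$ denotes the probability that the deck is in state $\sigma$ after one such shuffle started from $\mathrm{id}$. Nondecreasing $l$-paths: let $l=(l_1,\dots,l_{n-1})$ be a vector of positive integers with $i\le l_i\le n-1$. A nondecreasing $l$-path of length $n$ is an integer-valued path $\{Y_i\}_{i=1}^n$ satisfying $1\le Y_1\le Y_2\le\cdots\le Y_n=n$, with the strict inequality $Y_{i+1}>Y_i$ holding whenever $Y_i\le l_i$ ($1\le i\le n-1$). $N_n(l)$ is the number of such paths. The vector $l(\sigma)$: for $2\le j\le n-1$ let $I_j(\sigma)=\sum_{k=1}^{j-1}1_{\{\sigma^{-1}_k>\sigma^{-1}_j\}}$, the number of cards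 with number less than $j$ lying to the right of card $j$ in $\sigma$. Define $l(\sigma)=(l_1(\sigma),\dots,l_{n-1}(\sigma))$ by $l_{n-1}(\sigma)=n-1$ and $l_j(\sigma)=j+I_{n-j}(\sigma)$ for $j=1,\dots,n-2$. *)

(* Defs.v *)
From mathcomp Require Import all_boot all_order all_fingroup all_algebra.

Set Implicit Arguments.
Unset Strict Implicit.
Unset Printing Implicit Defensive.

Import Order.TTheory GRing.Theory Num.Theory.

(* Cards, positions and vector indices are 1-based natural numbers; only the
   underlying permutation ['S_n] acts on the 0-based type ['I_n].  Thus
   position [j.+1] of the row holds the card numbered [(sigma j).+1]. *)
Definition deck n (sigma : 'S_n) : seq nat :=
  [seq (sigma j).+1 | j <- enum 'I_n].

Definition card_pos n (sigma : 'S_n) (i : nat) : nat := (index i (deck sigma)).+1.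

(* [card_pos sigma] is sigma^{-1}. *)
Lemma card_posE n (sigma : 'S_n) (c : 'I_n) :
  card_pos sigma c.+1 = ((sigma^-1)%g c).+1.
Proof.
rewrite /card_pos /deck; congr _.+1.
have inj : injective (fun j : 'I_n => (sigma j).+1).
  by move=> x y [] /val_inj /perm_inj.
by rewrite -{1}(permKV sigma c) (index_map inj) index_enum_ord.
Qed.

(* The position [k] is counted after reinsertion: [c] ends up [k]-th from the
   left in the full row. *)
Definition reinsert (s : seq nat) (c k : nat) : seq nat :=
  let s' := rem c s in take k.-1 s' ++ c :: drop k.-1 s'.

(* [K i] is the (0-based) position chosen for the card that was in position [i]
   of the starting deck [tau]; the removal order is the left-to-right order of
   [tau], not of the evolving deck. *)
Definition shuffle n (tau : 'S_n) (K : {ffun 'I_n -> 'I_n}) : seq nat :=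
  foldl (fun s (i : 'I_n) => reinsert s (tau i).+1 (K i).+1) (deck tau) (enum 'I_n).

(* The positions are independent and uniform, so the vector of choices [K] has
   the product law, giving each [K] mass [\prod_i 1/n]. *)
Definition shuffle_prob n (tau sigma : 'S_n) : rat :=
  (\sum_(K : {ffun 'I_n -> 'I_n} | shuffle tau K == deck sigma)
     \prod_(i < n) (n%:R)^-1)%R.

(* Only [l 1, ..., l n.-1] and [Y 1, ..., Y n] are relevant. *)
Definition nondecreasing_path n (l Y : nat -> nat) : bool :=
  [&& 1 <= Y 1,
      all (fun i => Y i <= Y i.+1) (iota 1 n.-1),
      Y n == n
    & all (fun i => (Y i <= l i) ==> (Y i < Y i.+1)) (iota 1 n.-1)].

(* Such paths take values in [1, n], so they are counted among the tuples over
   ['I_n.+1] = {0, ..., n}; entry [i.-1] of the tuple is Y_i. *)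
Definition num_paths n (l : nat -> nat) : nat :=
  #|[set y : n.-tuple 'I_n.+1 |
       nondecreasing_path n l (fun i => nth 0 (map val y) i.-1)]|.

Definition inv_count n (sigma : 'S_n) (j : nat) : nat :=
  \sum_(1 <= k < j) (card_pos sigma k > card_pos sigma j).

Definition lvec n (sigma : 'S_n) (j : nat) : nat :=
  if j == n.-1 then n.-1 else j + inv_count sigma (n - j).

(* [lvec sigma] satisfies the standing constraint on the vectors [l]. *)
Lemma lvec_bounds n (sigma : 'S_n) (j : nat) :
  1 <= j <= n.-1 -> j <= lvec sigma j <= n.-1.
Proof.
case/andP=> j1 jn; rewrite /lvec; case: eqP => [->|_]; first by rewrite leqnn.
rewrite leq_addr /=.
have h : inv_count sigma (n - j) <= (n - j).-1.
  apply: (@leq_trans (\sum_(1 <= k < n - j) 1)).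
    by apply: leq_sum => k _; case: (_ < _).
  by rewrite sum_nat_const_nat muln1 subn1.
apply: leq_trans (leq_add (leqnn j) h) _.
by rewrite predn_sub subnKC.
Qed.

(* Main.v *)
(* Run the shuffle backwards from [sigma].  Before card [i] is moved, cards
   [i, ..., n] stand in increasing order, and cards [1, ..., i-1] stand in their
   relative order in [sigma]; hence the only freedom in undoing the move of card
   [i] is to put it back anywhere among the cards preceding the first unmoved
   one.  If [m_i] is the number of cards preceding the first unmoved card once
   cards [1, ..., i] have been moved, then [m_n = n], and removing card [i] from
   this initial run shows that [m_(i-1)] can be any number in
   [0, m_i - e], where [e = 1] if card [i], whose rank among the moved cards is
   [i - I_i], satisfies [i - I_i <= m_i], and [e = 0] otherwise.  The histories
   leading to [sigma] thus correspond to the sequences [m], and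
   [Y_j = n - m_(n-j)] (with [Y_0 = 0]) turns these into [l]-paths. *)
Require Import Defs.
From mathcomp Require Import all_boot all_order all_fingroup all_algebra.
From mathcomp Require Import zify.

Set Implicit Arguments.
Unset Strict Implicit.
Unset Printing Implicit Defensive.

(** * Sums over tuples and counting *)

Lemma big_tuple_cons (T : finType) m (F : m.+1.-tuple T -> nat) :
  \sum_t F t = \sum_(t : m.-tuple T) \sum_(x : T) F (cons_tuple x t).
Proof.
rewrite pair_big /=.
rewrite (reindex (fun p : m.-tuple T * T => cons_tuple p.2 p.1)) //=.
exists (fun t => (behead_tuple t, thead t)) => [[t x] _ | t _] /=.
  by congr pair; apply: val_inj.
by rewrite [RHS]tuple_eta.
Qed.

Lemma count_mem_sym (T : eqType) (s t : seq T) :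
  uniq s -> uniq t -> count [in s] t = count [in t] s.
Proof.
move=> us ut; rewrite -!size_filter; apply: perm_size; apply: uniq_perm.
- exact: filter_uniq.
- exact: filter_uniq.
by move=> x; rewrite !mem_filter andbC.
Qed.

Lemma find_le_count (T : Type) (a : pred T) s : find a s <= count (predC a) s.
Proof. by elim: s => //= x s IH; case: (a x). Qed.

(** * Inserting a card into a row and undoing it *)

Definition ins k (c : nat) (r : seq nat) : seq nat := take k r ++ c :: drop k r.

Lemma perm_ins k c r : perm_eq (ins k c r) (c :: r).
Proof. by rewrite /ins perm_catC /= perm_cons perm_catC cat_take_drop. Qed.

Lemma ins_eq k c (r s : seq nat) : k <= size r -> c \notin r -> c \in s ->
  (s == ins k c r) = (k == index c s) && (rem c s == r).
Proof.
move=> kr cr cs; apply/eqP/andP => [->|[/eqP-> /eqP<-]].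
  have ctk : c \notin take k r by apply: contra cr; apply: mem_take.
  have e : index c (ins k c r) = k.
    by rewrite /ins index_cat (negPf ctk) /= eqxx addn0 size_takel.
  split; first by rewrite e.
  by rewrite remE e /ins take_size_cat ?size_takel // drop_cat size_takel //
    ltnNge leqnSn /= subSnn /= drop0 cat_take_drop.
have si : size (take (index c s) s) = index c s by rewrite size_takel ?index_size.
rewrite /ins remE take_size_cat // drop_size_cat //.
by rewrite -{1}(cat_take_drop (index c s) s) drop_index.
Qed.

(** Only [k = index c s] can contribute, since an inserted new card reveals its own position. *)
Lemma sum_ins n c (r s : seq nat) : (size r).+1 = n -> c \notin r -> c \in s ->
  \sum_(k < n) (s == ins k c r : nat) = (rem c s == r).
Proof.
move=> sr cr cs.
rewrite (eq_bigr (fun k : 'I_n => ((k == index c s :> nat) && (rem c s == r) : nat)));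
  last by move=> k _; rewrite ins_eq // -ltnS sr.
case: eqP => [er|_]; last by rewrite big1 // => k _; rewrite andbF.
have idx : index c s < n.
  by rewrite -sr -er size_rem // prednK ?index_mem // -has_predT; apply/hasP; exists c.
rewrite (bigD1 (Ordinal idx)) //= eqxx big1 // => k /eqP kn.
by rewrite andbT; case: eqP => // e; case: kn; apply: val_inj.
Qed.

(** * Decks reached from the identity by a partial shuffle *)

Section Shuffle.

Variable n : nat.

(* [ks] lists the chosen positions, the most recent one first. *)
Fixpoint deck_after (ks : seq nat) : seq nat :=
  if ks is k :: ks' then ins k (size ks').+1 (rem (size ks').+1 (deck_after ks'))
  else iota 1 n.

Lemma perm_deck_after ks : size ks <= n -> perm_eq (deck_after ks) (iota 1 n).
Proof.
elim: ks => //= k ks IH sk.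
apply: perm_trans (perm_ins _ _ _) _.
have p := IH (ltnW sk).
have h : (size ks).+1 \in deck_after ks by rewrite (perm_mem p) mem_iota; lia.
by rewrite (perm_trans _ p) // perm_sym perm_to_rem.
Qed.

Lemma filter_ins (a : pred nat) k c r : ~~ a c -> filter a (ins k c r) = filter a r.
Proof. by move=> /negPf ac; rewrite /ins filter_cat /= ac -filter_cat cat_take_drop. Qed.

Lemma filter_rem (a : pred nat) c r : ~~ a c -> filter a (rem c r) = filter a r.
Proof.
move=> /negPf ac; elim: r => //= x r IH.
by case: eqP => [->|_]; rewrite ?ac //= IH.
Qed.

(** A move displaces only the card being moved, so the cards still waiting keep their initial
    order. *)
Lemma filter_deck_after ks : size ks <= n ->
  filter (fun x => size ks < x) (deck_after ks) = iota (size ks).+1 (n - size ks).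
Proof.
elim: ks => [|k ks IH] /=.
  by move=> _; rewrite subn0; apply/all_filterP/allP => x; rewrite mem_iota; case/andP.
move=> sk; rewrite filter_ins ?ltnn // filter_rem ?ltnn //.
have := IH (ltnW sk).
have -> : n - size ks = (n - (size ks).+1).+1 by lia.
move=> /(congr1 (filter (fun x => (size ks).+1 < x))) /=; rewrite ltnn.
rewrite -filter_predI (_ : filter _ (iota _ _) = iota (size ks).+2 (n - (size ks).+1)).
  by move=> <-; apply: eq_filter => x /=; lia.
by apply/all_filterP/allP => x; rewrite mem_iota; case/andP.
Qed.

Definition num_to i s : nat :=
  \sum_(t : i.-tuple 'I_n) (deck_after (map val t) == s).

(** For fixed earlier choices leading to a deck [d], the forward positions of card [i.+1] that reach
    [s] and the backward positions [p] that restore [d] are equally many: one if [d] and [s] agree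
    without that card, none otherwise. *)
Lemma num_toS i s : i < n -> perm_eq s (iota 1 n) ->
  num_to i.+1 s = \sum_(p < n) num_to i (ins p i.+1 (rem i.+1 s)).
Proof.
move=> lt_in ps.
have us : uniq s by rewrite (perm_uniq ps) iota_uniq.
have inn d : perm_eq d (iota 1 n) -> i.+1 \in d.
  by move=> p; rewrite (perm_mem p) mem_iota; lia.
have nin d : perm_eq d (iota 1 n) -> i.+1 \notin rem i.+1 d.
  by move=> p; rewrite mem_rem_uniq ?inE ?eqxx // (perm_uniq p) iota_uniq.
have sz d : perm_eq d (iota 1 n) -> (size (rem i.+1 d)).+1 = n.
  move=> p; rewrite size_rem ?inn // (perm_size p) size_iota; lia.
rewrite /num_to big_tuple_cons [RHS]exchange_big; apply: eq_bigr => t _ /=.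
have st : size (map val t) = i by rewrite size_map size_tuple.
have pt : perm_eq (deck_after (map val t)) (iota 1 n) by apply: perm_deck_after; rewrite st ltnW.
rewrite st.
under eq_bigr do rewrite eq_sym.
rewrite sum_ins ?nin ?inn ?sz // sum_ins ?nin ?inn ?sz //.
by rewrite eq_sym.
Qed.

Lemma num_to_eq0 i s : i <= n ->
  filter (fun x => i < x) s != iota i.+1 (n - i) -> num_to i s = 0.
Proof.
move=> le_in fs; rewrite /num_to big1 // => t _; case: eqP => // e.
have st : size (map val t) = i by rewrite size_map size_tuple.
by case/eqP: fs; have := @filter_deck_after (map val t); rewrite st e; apply.
Qed.

(** * Tails of nondecreasing paths *)

(* [l] is read from index [j] on and [y] is Y_j. *)
Fixpoint lpath (l : nat -> nat) j y (ys : seq nat) : bool :=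
  if ys is y' :: ys' then (y + (y <= l j) <= y') && lpath l j.+1 y' ys' else y == n.

(** The tail starts at index [n - i], so [i] counts both the entries still to come and, in the
    correspondence, the cards already moved. *)
Definition num_tails l i y : nat :=
  \sum_(t : i.-tuple 'I_n.+1) lpath l (n - i) y (map val t).

Lemma num_tailsS l i y : i < n ->
  num_tails l i.+1 y =
  \sum_(y' < n.+1 | y + (y <= l (n - i.+1)) <= y') num_tails l i y'.
Proof.
move=> lt_in; rewrite /num_tails big_tuple_cons exchange_big /= [RHS]big_mkcond /=.
apply: eq_bigr => y' _; rewrite -subSn //; case: ifP => _; last by rewrite big1.
by rewrite subSS.
Qed.

Lemma lpathE l j y ys :
  lpath l j y ys =
  all (fun i => nth 0 (y :: ys) i + (nth 0 (y :: ys) i <= l (j + i)) <= nth 0 ys i)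
    (iota 0 (size ys)) && (last y ys == n).
Proof.
elim: ys j y => //= y' ys IH j y.
rewrite IH addn0 -andbA; congr (_ && (_ && _)).
rewrite -[1]/(1 + 0) iotaDl all_map; apply: eq_all => i /=.
by rewrite addSnnS.
Qed.

(** The added start Y_0 = 0 satisfies [0 <= l 0] for every [l], so its forced strict step is exactly
    the condition [1 <= Y 1]. *)
Lemma nondecreasing_pathE l ys : 0 < n -> size ys = n ->
  nondecreasing_path n l (fun i => nth 0 ys i.-1) = lpath l 0 0 ys.
Proof.
move=> n0 sy; rewrite lpathE sy -(nth_last 0) /nondecreasing_path.
have -> : iota 0 n = 0 :: iota 1 n.-1 by case: n n0.
case: ys sy => [|y ys] sy; first by rewrite -sy in n0.
rewrite /= -sy /= [all _ _ in RHS](_ : _ =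
    all (fun i => nth 0 (y :: ys) i.-1 <= nth 0 (y :: ys) i) (iota 1 (size ys)) &&
    all (fun i => (nth 0 (y :: ys) i.-1 <= l i) ==>
      (nth 0 (y :: ys) i.-1 < nth 0 (y :: ys) i)) (iota 1 (size ys))).
  by rewrite -!andbA [X in _ && (_ && X)]andbC.
rewrite -all_predI; apply: eq_in_all => -[|i]; rewrite mem_iota // => _ /=.
by rewrite add0n; case: leqP => /=; lia.
Qed.

Lemma num_pathsE l : 0 < n -> num_paths n l = num_tails l n 0.
Proof.
move=> n0; rewrite /num_paths /num_tails cardsE -sum1_card big_mkcond /=.
by apply: eq_bigr => t _; rewrite subnn -nondecreasing_pathE ?size_map ?size_tuple.
Qed.

End Shuffle.

(** * Backward induction from the target permutation *)

Section Target.

Variables (n : nat) (sigma : 'S_n).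

Lemma iota1E : iota 1 n = map succn (map val (enum 'I_n)).
Proof. by rewrite val_enum_ord -(iotaDl 1). Qed.

Lemma perm_deck : perm_eq (deck sigma) (iota 1 n).
Proof.
rewrite iota1E /deck -map_comp.
rewrite (map_comp (fun j : 'I_n => (val j).+1) sigma) perm_map //.
apply: uniq_perm; rewrite ?(map_inj_uniq (@perm_inj _ sigma)) ?enum_uniq // => j.
by rewrite mem_enum -{1}(permKV sigma j) map_f ?mem_enum.
Qed.

(** Each of the [c.-1] smaller cards lies either to the left of [c], where the index counts it, or
    to the right, where [inv_count] does. *)
Lemma inv_count_index c : 0 < c <= n ->
  index c (filter (fun x => x <= c) (deck sigma)) + inv_count sigma c = c.-1.
Proof.
move=> cn; set D := deck sigma.
have uD : uniq D by rewrite (perm_uniq perm_deck) iota_uniq.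
have cD : c \in D by rewrite (perm_mem perm_deck) mem_iota; lia.
have -> : index c (filter (fun x => x <= c) D) =
          \sum_(1 <= k < c) (index k D < index c D).
  have [a [b [eD ca]]] : exists a b, D = a ++ c :: b /\ c \notin a.
    case/splitPr: cD uD => a b; rewrite cat_uniq => /and3P[_ /norP[ca _] _].
    by exists a, b.
  have ua : uniq a by move: uD; rewrite eD cat_uniq; case/andP.
  rewrite eD filter_cat /= leqnn index_cat mem_filter (negPf ca) andbF /= eqxx addn0.
  rewrite size_filter -[RHS]big_mkcond /= sum1_count.
  rewrite [RHS](@eq_count _ _ [in a]) => [|k]; last first.
    rewrite /= [index c _]index_cat (negPf ca) /= eqxx addn0 index_cat.
    by case: ifP => ka; rewrite ?index_mem // ltnNge leq_addr.
  rewrite count_mem_sym ?iota_uniq //; apply: eq_in_count => x xa.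
  have : x \in iota 1 n by rewrite -(perm_mem perm_deck) -/D eD mem_cat xa.
  rewrite mem_iota => x1n.
  have : x != c by apply: contraNneq ca => <-.
  rewrite /= mem_index_iota; lia.
rewrite /inv_count -big_split /= (eq_big_nat _ _ (F2 := fun=> 1)) => [|k kc].
  by rewrite sum_nat_const_nat muln1 subn1.
have kD : k \in D by rewrite (perm_mem perm_deck) mem_iota; lia.
have : index k D != index c D.
  by apply/eqP => /(congr1 (nth 0 D)); rewrite !nth_index //; lia.
rewrite /card_pos -/D; lia.
Qed.

(* The decks that can lead to [sigma] once the cards [1, ..., i] have moved. *)
Definition compatible i (s : seq nat) :=
  filter (fun x => x <= i) s = filter (fun x => x <= i) (deck sigma) /\
  filter (fun x => i < x) s = iota i.+1 (n - i).

Lemma compatible_perm i s : i <= n -> compatible i s -> perm_eq s (iota 1 n).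
Proof.
move=> le_in [le_s gt_s].
rewrite -(perm_filterC (fun x => x <= i)) le_s.
rewrite (@eq_filter _ (predC _) (fun x => i < x)) => [|x]; last by rewrite /= ltnNge.
rewrite gt_s.
have p : perm_eq (filter (fun x => x <= i) (deck sigma)) (iota 1 i).
  have -> : iota 1 i = filter (fun x => x <= i) (iota 1 n).
    rewrite -(subnKC le_in) iotaD filter_cat.
    rewrite (all_filterP _); last by apply/allP => x; rewrite mem_iota; lia.
    rewrite (@eq_in_filter _ _ pred0) ?filter_pred0 ?cats0 // => x; rewrite mem_iota /=; lia.
  by rewrite perm_filter ?perm_deck.
by rewrite -[X in perm_eq _ (iota 1 X)](subnKC le_in) iotaD perm_cat2r.
Qed.

(** The separately defined entry [n.-1] fits the general formula because card 1 has no
    inversions. *)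
Lemma lvecE i : i < n -> lvec sigma (n - i.+1) = n - i.+1 + inv_count sigma i.+1.
Proof.
move=> lt_in; rewrite /lvec subKn //; case: eqP => // e.
have -> : i = 0 by lia.
by rewrite /inv_count big_geq // addn0 subn1.
Qed.

(* Removing card [i.+1] shortens the initial run of already moved cards exactly
   when its rank among the moved cards falls inside that run. *)
Lemma find_rem_compatible i s : i < n -> compatible i.+1 s ->
  n - find (fun x => i.+1 < x) (rem i.+1 s) =
  n - find (fun x => i.+1 < x) s +
    (n - find (fun x => i.+1 < x) s <= lvec sigma (n - i.+1)).
Proof.
move=> lt_in cs; have ps := compatible_perm lt_in cs.
have := @inv_count_index i.+1 lt_in; rewrite -(proj1 cs) lvecE //=.
have ins_ : i.+1 \in s by rewrite (perm_mem ps) mem_iota; lia.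
have us : uniq s by rewrite (perm_uniq ps) iota_uniq.
have := find_size (fun x => i.+1 < x) s.
rewrite (perm_size ps) size_iota.
case/splitPr: ins_ us => a b; rewrite cat_uniq => /and3P[_ /norP[ca _] _].
rewrite remE index_cat (negPf ca) /= eqxx addn0 take_size_cat //.
rewrite drop_cat ltnNge leqnSn /= subSnn /= drop0.
rewrite filter_cat /= leqnn index_cat mem_filter (negPf ca) andbF /= eqxx addn0.
rewrite size_filter !find_cat /= ltnn.
(* If [a] holds an unmoved card, the run ends inside [a] and its length is at most the number of
   moved cards in [a], hence below the rank of card [i.+1]; otherwise the run contains that card and
   loses one place. *)
have := find_le_count (fun x => i.+1 < x) a.
rewrite (@eq_count _ (predC _) (fun x => x <= i.+1)) => [|x]; last by rewrite /= -leqNgt.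
have := count_size (fun x => x <= i.+1) a.
case: ifP => _; lia.
Qed.

(** Each position [p] to which card [i.+1] may be put back is itself the next initial run length, so
    summing over [p] reproduces [num_tailsS] with y' = [n - p]. *)
Lemma num_to_compatible i s : i <= n -> compatible i s ->
  num_to n i s = num_tails n (lvec sigma) i (n - find (fun x => i < x) s).
Proof.
elim: i s => [|i IH] s le_in cs; have ps := compatible_perm le_in cs.
  have es : s = iota 1 n.
    case: cs => _; rewrite subn0 => <-; apply/esym/all_filterP/allP => x.
    by rewrite (perm_mem ps) mem_iota; case/andP.
  rewrite /num_to /num_tails !(big_pred1 [tuple]) => [|t|t]; rewrite /= ?[t]tuple0 ?eqxx //.
  by rewrite /= es eqxx; case: {+}n => //= k; rewrite subn0 eqxx.
rewrite num_toS // num_tailsS // -find_rem_compatible //.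
set r := rem i.+1 s; set M := find _ r.
have us : uniq s by rewrite (perm_uniq ps) iota_uniq.
have cins : i.+1 \in s by rewrite (perm_mem ps) mem_iota; lia.
have cr : i.+1 \notin r by rewrite mem_rem_uniq ?inE ?eqxx.
have sr : (size r).+1 = n by rewrite size_rem // (perm_size ps) size_iota; lia.
have Mr : M <= size r := find_size _ _.
have eqr x : x \in r -> (i < x) = (i.+1 < x).
  by move=> xr; rewrite leq_eqVlt [_ == _](_ : _ = false) //; apply: contraNF cr => /eqP->.
have hasE p : p < n -> has (fun x => i < x) (take p r) = (M < p).
  move=> pn; rewrite -has_take_leq; last lia.
  by apply: eq_in_has => x /mem_take /eqr.
have comp p : p <= M -> compatible i (ins p i.+1 r).
  move=> pM; have pn : p < n by lia.
  case: cs => le_s gt_s; split.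
    rewrite filter_ins ?ltnn // filter_rem ?ltnn //.
    have e t : filter (fun x => x <= i) t =
               filter (fun x => x <= i) (filter (fun x => x <= i.+1) t).
      by rewrite -filter_predI; apply: eq_filter => x /=; lia.
    by rewrite e le_s -e.
  rewrite /ins filter_cat /= leqnn.
  have := hasE p pn; rewrite has_filter ltnNge pM /= => /negbFE/eqP e.
  rewrite e /=; have -> : n - i = (n - i.+1).+1 by lia.
  rewrite /=; congr (_ :: _); rewrite -gt_s -[in RHS](@filter_rem _ i.+1) ?ltnn //.
  rewrite -(eq_in_filter eqr) -[in RHS](cat_take_drop p r) filter_cat -/r.
  by rewrite e.
have findE p : p <= M -> find (fun x => i < x) (ins p i.+1 r) = p.
  move=> pM; have pn : p < n by lia.
  by rewrite /ins find_cat hasE // ltnNge pM /= leqnn addn0 size_takel ?(leq_trans pM).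
(* Put back beyond [M], card [i.+1] would stand behind a larger unmoved card, which no partial
   shuffle allows. *)
have zero p : p < n -> M < p -> num_to n i (ins p i.+1 r) = 0.
  move=> pn Mp; apply: num_to_eq0; first exact: ltnW.
  have -> : n - i = (n - i.+1).+1 by lia.
  have := hasE p pn; rewrite Mp has_filter /ins filter_cat.
  case e : filter => [|x t] //= _; apply/eqP => -[ex _].
  have : x \in filter (fun x => i < x) (take p r) by rewrite e inE eqxx.
  by rewrite mem_filter ex => /andP[_ /mem_take]; rewrite (negPf cr).
(* Substitute y' = [n - p]; the extra term [p = n] gives y' = 0, which is excluded because
   [M < n]. *)
rewrite [RHS](reindex_inj rev_ord_inj) /= [RHS]big_mkcond big_ord_recr /=.
rewrite [X in _ + X](_ : _ = 0) ?addn0; last by rewrite subnn ifN //; lia.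
apply: eq_bigr => p _; rewrite subSS; have pn := ltn_ord p.
case: (leqP p M) => pM.
  by rewrite IH ?findE ?(ltnW le_in) ?ifT //; [lia | exact: comp].
by rewrite zero // ifN //; lia.
Qed.

(** * From position vectors to counted histories *)

Lemma shuffle1E (K : {ffun 'I_n -> 'I_n}) :
  shuffle 1%g K = deck_after n (rev [seq val (K i) | i <- enum 'I_n]).
Proof.
have d1 : deck (1%g : 'S_n) = iota 1 n.
  by rewrite iota1E -map_comp; apply: eq_map => j; rewrite perm1.
rewrite /shuffle d1.
(* From the identity, the card moved after [m] moves is [m.+1], the number that [deck_after] reads
   off the length of its list. *)
suff H m : m <= n -> foldl (fun s (i : 'I_n) => reinsert s ((1%g : 'S_n) i).+1 (K i).+1)
    (iota 1 n) (take m (enum 'I_n)) =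
    deck_after n (rev [seq val (K i) | i <- take m (enum 'I_n)]).
  by have := H n (leqnn n); rewrite take_oversize ?size_enum_ord.
elim: m => [|m IH] lt_mn; first by rewrite take0.
have sz : size (enum 'I_n) = n by rewrite size_enum_ord.
rewrite (take_nth (Ordinal lt_mn)) ?sz // foldl_rcons IH ?(ltnW lt_mn) //.
rewrite map_rcons rev_rcons /= size_rev size_map size_takel ?sz ?(ltnW lt_mn) //.
by rewrite perm1 nth_enum_ord.
Qed.

Lemma card_shuffle1 : #|[pred K : {ffun 'I_n -> 'I_n} | shuffle 1%g K == deck sigma]| =
  num_to n n (deck sigma).
Proof.
rewrite -sum1_card big_mkcond /=.
rewrite /num_to (reindex (fun K : {ffun 'I_n -> 'I_n} => [tuple of rev [tuple K i | i < n]])) /=.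
  apply: eq_bigr => K _; rewrite inE shuffle1E map_rev -map_comp.
  by case: eqP.
exists (fun t : n.-tuple 'I_n => [ffun i => tnth [tuple of rev t] i]) => [K _ | t _].
  apply/ffunP => i; rewrite ffunE -[RHS](tnth_mktuple K).
  by congr tnth; apply: val_inj; rewrite /= revK.
apply: val_inj => /=; rewrite -[RHS]revK; congr rev.
rewrite -[RHS]/(val [tuple of rev t]) [in RHS](tuple_map_ord [tuple of rev t]) /=.
by apply: eq_map => i; rewrite ffunE.
Qed.

End Target.

Theorem theorem5 (n : nat) (hn : 0 < n) (sigma : 'S_n) :
  (shuffle_prob (1%g : 'S_n) sigma = (num_paths n (lvec sigma))%:R / (n ^ n)%:R)%R.
Proof.
rewrite num_pathsE //.
have pd := perm_deck sigma.
have le_n x : x \in deck sigma -> (n < x) = false.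
  by rewrite (perm_mem pd) mem_iota; lia.
(* No card exceeds [n], so [find] returns the size [n] by default: m_n = n, that is Y_0 = 0. *)
have find_n : find (fun x => n < x) (deck sigma) = n.
  rewrite hasNfind ?(perm_size pd) ?size_iota //.
  by apply/hasPn => x /le_n ->.
have comp : compatible sigma n (deck sigma).
  by split=> //; rewrite subnn (eq_in_filter le_n) filter_pred0.
have := num_to_compatible (leqnn n) comp; rewrite find_n subnn => <-.
rewrite -card_shuffle1 /shuffle_prob GRing.prodr_const card_ord.
by rewrite GRing.natrX GRing.exprVn GRing.mulr_natl -GRing.sumr_const.
Qed.
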